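(* Let $\mathbb{T}$ be a time scale, $f:\mathbb{T}\to\mathcal{F}_N(\mathbb{R})$, $s\in\mathbb{T}_\kappa^\kappa$ and $0<\alpha<1$. If $f$ is $\diamond_{gH}^\alpha$-differentiable at $s$, then $f$ is both $\Delta_{gH}$-differentiable and $\nabla_{gH}$-differentiable at $s$.
   Context: A time scale $\mathbb{T}$ is a nonempty closed subset of $\mathbb{R}$. The forward and backward jump operators are $\sigma(t)=\inf\{s\in\mathbb{T}:s>t\}$ (with $\inf\varnothing:=\sup\mathbb{T}$) and $\rho(t)=\sup\{s\in\mathbb{T}:s<t\}$ (with $\sup\varnothing:=\inf\mathbb{T}$). A point $t$ is right-scattered if $\sigma(t)>t$ and left-scattered if $\rho(t)<t$. $\mathbb{T}^\kappa$ is $\mathbb{T}$ with its maximum removed if $\mathbb{T}$ has a left-scattered maximum, and $\mathbb{T}^\kappa=\mathbb{T}$ otherwise; $\mathbb{T}_\kappa$ is $\mathbb{T}$ with its minimum removed if $\mathbb{T}$ has a right-scattered minimum, and $\mathbb{T}_\kappa=\mathbb{T}$ otherwise; $\mathbb{T}_\kappa^\kappa=\mathbb{T}^\kappa\cap\mathbb{T}_\kappa$. Write $\mu_{st}=\sigma(s)-t$ and $\nu_{st}=t-\rho(s)$. A fuzzy number is a function $u:\mathbb{R}\to[0,1]$ that is normal ($u(x_0)=1$ for some $x_0$), quasiconcave, upper semicontinuous, and has compact support $\mathrm{cl}\{x:u(x)>0\}$; $\mathcal{F}_N(\mathbb{R})$ is the set of fuzzy numbers. The $r$-level sets are $u_r=\{x:u(x)\ge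 r\}$ for $0<r\le1$ and $u_0=\mathrm{cl}\{x:u(x)>0\}$; they are compact intervals $u_r=[u_r^-,u_r^+]$. Addition and multiplication by real scalars are levelwise: $(u+v)_r=u_r+v_r$, $(cu)_r=c\,u_r$ (interval operations). The generalized Hukuhara difference $u\ominus_{gH}v$ is the fuzzy number $w$, if it exists, such that $u=v+w$ or $v=u+(-1)w$. The metric is $D_\infty(u,v)=\sup_{r\in[0,1]}\max\{|u_r^--v_r^-|,|u_r^+-v_r^+|\}$. Derivatives (each is a fuzzy number, if it exists, such that for every $\epsilon>0$ there is $\delta>0$ such that for all $t\in(s-\delta,s+\delta)\cap\mathbb{T}$ the gH-differences involved exist and the stated inequality holds): $\Delta_{gH}$-derivative ($s\in\mathbb{T}^\kappa$): $D_\infty\big(f(\sigma(s))\ominus_{gH}f(t),(\Delta_{gH}f)(s)\mu_{st}\big)\le\epsilon|\mu_{st}|$. $\nabla_{gH}$-derivative ($s\in\mathbb{T}_\kappa$): $D_\infty\big(f(t)\ominus_{gH}f(\rho(s)),(\nabla_{gH}f)(s)\nu_{st}\big)\le\epsilon|\nu_{st}|$. $\diamond_{gH}^\alpha$-derivative ($s\in\mathbb{T}_\kappa^\kappa$): $D_\infty\big(\alpha[f(\sigma(s))\ominus_{gH}f(t)]\nu_{st}+(1-\alpha)[f(t)\ominus_{gH}f(\rho(s))]\mu_{st},(\diamond_{gH}^\alpha f)(s)\mu_{st}\nu_{st}\big)\le\epsilon|\mu_{st}\nu_{st}|$. $f$ is called $\Delta_{gH}$-, $\nabla_{gH}$-,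 or $\diamond_{gH}^\alpha$-differentiable at $s$ if the corresponding derivative exists. *)

(* Defs.v *)
From HB Require Import structures.
From mathcomp Require Import all_boot all_order all_algebra.
From mathcomp Require Import all_classical all_reals all_analysis.
From mathcomp Require Import ring lra.

Set Implicit Arguments.
Unset Strict Implicit.
Unset Printing Implicit Defensive.

Import Order.TTheory GRing.Theory Num.Theory numFieldNormedType.Exports.

Local Open Scope classical_set_scope.
Local Open Scope ring_scope.

Section TimeScale.
Context {R : realType}.
Implicit Types (T : set R) (s t : R).

Definition time_scale T : Prop := T !=set0 /\ closed T.

(* The junk values of [sup] and [inf] on unbounded sets are never reached for
   [t] in [T]: if no point of [T] exceeds [t] then [T] is bounded above by [t],
   and symmetrically for [rho]. *)
Definition sigma T t : R :=
  if `[< [set s | T s /\ t < s] = set0 >] then sup T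
  else inf [set s | T s /\ t < s].

Definition rho T t : R :=
  if `[< [set s | T s /\ s < t] = set0 >] then inf T
  else sup [set s | T s /\ s < t].

Definition right_scattered T t : Prop := t < sigma T t.
Definition left_scattered T t : Prop := rho T t < t.

Definition is_max T t : Prop := T t /\ ubound T t.
Definition is_min T t : Prop := T t /\ lbound T t.

Definition kappa_up T : set R :=
  T `\` [set t | is_max T t /\ left_scattered T t].
Definition kappa_low T : set R :=
  T `\` [set t | is_min T t /\ right_scattered T t].
Definition kappa_both T : set R := kappa_up T `&` kappa_low T.

Definition mu T s t : R := sigma T s - t.
Definition nu T s t : R := t - rho T s.

End TimeScale.

Section FuzzyNumber.
Context {R : realType}.

Definition quasiconcave (u : R -> R) : Prop :=
  forall x y l, 0 <= l <= 1 ->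
    Num.min (u x) (u y) <= u (l * x + (1 - l) * y).

(* Real-valued dual of the library's [lower_semicontinuous]. *)
Definition upper_semicontinuous (u : R -> R) : Prop :=
  forall x a, u x < a -> \forall y \near x, u y < a.

Record fuzzy := Fuzzy {
  fuzzy_fun :> R -> R ;
  fuzzy_itv : forall x, 0 <= fuzzy_fun x <= 1 ;
  fuzzy_normal : exists x0, fuzzy_fun x0 = 1 ;
  fuzzy_quasiconcave : quasiconcave fuzzy_fun ;
  fuzzy_usc : upper_semicontinuous fuzzy_fun ;
  fuzzy_compact : compact (closure [set x | 0 < fuzzy_fun x])
}.

Definition level (u : fuzzy) (r : R) : set R :=
  if 0 < r then [set x | r <= u x] else closure [set x | 0 < u x].

Definition level_inf (u : fuzzy) (r : R) : R := inf (level u r).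
Definition level_sup (u : fuzzy) (r : R) : R := sup (level u r).

Definition Dinf (u v : fuzzy) : R :=
  sup [set Num.max `|level_inf u r - level_inf v r|
                   `|level_sup u r - level_sup v r| | r in `[0, 1]%classic].

Lemma fuzzy_fun_inj (u v : fuzzy) : (forall x, u x = v x) -> u = v.
Proof.
case: u v => [u a b c d e] [v a' b' c' d' e'] /= uv.
have {}uv : u = v by apply: funext.
subst v; congr Fuzzy; exact: Prop_irrelevance.
Qed.

Lemma fuzzy_ge0 (u : fuzzy) x : 0 <= u x.
Proof. by have /andP[] := fuzzy_itv u x. Qed.

Lemma fuzzy_le1 (u : fuzzy) x : u x <= 1.
Proof. by have /andP[] := fuzzy_itv u x. Qed.

Lemma level_gt0 (u : fuzzy) r : 0 < r -> level u r = [set x | r <= u x].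
Proof. by rewrite /level => ->. Qed.

Lemma level0 (u : fuzzy) : level u 0 = closure [set x | 0 < u x].
Proof. by rewrite /level ltxx. Qed.

Lemma level_ext (u v : fuzzy) :
  (forall r, 0 <= r <= 1 -> level u r = level v r) -> u = v.
Proof.
move=> uv; apply: fuzzy_fun_inj => x.
wlog suff le : u v uv / u x <= v x.
  by apply/le_anti/andP; split; apply: le => // r r01; rewrite uv.
have := fuzzy_ge0 u x; rewrite le_eqVlt => /predU1P[<-|u0].
  exact: fuzzy_ge0.
have := uv (u x); rewrite !level_gt0// (ltW u0) fuzzy_le1 => /(_ isT) E.
have : [set y | u x <= u y] x by rewrite /= lexx.
by rewrite E.
Qed.

Lemma level_nonincr (u : fuzzy) r r' : 0 <= r' <= r -> level u r `<=` level u r'.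
Proof.
move=> /andP[]; rewrite le_eqVlt => /predU1P[<-|r'0] r'r.
  rewrite level0; have [r0|r0] := ltP 0 r.
    rewrite level_gt0// => x /= rx; apply: subset_closure => /=.
    exact: lt_le_trans rx.
  by rewrite (@le_anti _ _ r 0) ?r0// level0.
rewrite !level_gt0 ?(lt_le_trans r'0)// => x /=; exact: le_trans.
Qed.

Lemma level_closed (u : fuzzy) r : closed (level u r).
Proof.
rewrite /level; case: ifPn => r0; last exact: closed_closure.
rewrite (_ : mkset _ = ~` [set x | u x < r]); last first.
  by apply/seteqP; split=> x /=; [rewrite leNgt => /negP|move=> /negP; rewrite -leNgt].
by apply: open_closedC; rewrite openE => x /= /fuzzy_usc.
Qed.

Lemma level_compact (u : fuzzy) r : 0 <= r -> compact (level u r).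
Proof.
move=> r0; apply: (@subclosed_compact _ _ (level u 0)).
- exact: level_closed.
- rewrite level0; exact: fuzzy_compact.
- by apply: level_nonincr; rewrite lexx.
Qed.

Lemma level_neq0 (u : fuzzy) r : r <= 1 -> level u r !=set0.
Proof.
move=> r1; have [x ux] := fuzzy_normal u; exists x; rewrite /level.
case: ifP => _ /=; first by rewrite ux.
by apply: subset_closure => /=; rewrite ux.
Qed.

Definition convex (A : set R) : Prop :=
  forall x y l, A x -> A y -> 0 <= l <= 1 -> A (l * x + (1 - l) * y).

Lemma closure_convex (A : set R) : convex A -> convex (closure A).
Proof.
move=> cA x y l Ax Ay l01 B Bxy.
have ct : (fun p : R * R => l * p.1 + (1 - l) * p.2) @ (x, y)
    --> l * x + (1 - l) * y.
  apply: (@cvgD _ _ _ _ _ (fun p : R * R => l * p.1)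
    (fun p : R * R => (1 - l) * p.2));
    apply: cvgMr; [exact: cvg_fst|exact: cvg_snd].
have [[V W]/= [Vx Wy] VW] := ct _ Bxy.
have [a [Aa Va]] := Ax _ Vx.
have [b [Ab Wb]] := Ay _ Wy.
exists (l * a + (1 - l) * b); split; first exact: cA.
exact: (VW (a, b)).
Qed.

Lemma level_convex (u : fuzzy) r : convex (level u r).
Proof.
rewrite /level; case: ifPn => r0; last apply: closure_convex;
  move=> x y l /= ux uy l01.
- by apply: le_trans (fuzzy_quasiconcave u x y l01); rewrite le_min ux.
- by apply: lt_le_trans (fuzzy_quasiconcave u x y l01); rewrite lt_min ux.
Qed.

Lemma level_left (u : fuzzy) r x : 0 < r ->
  (forall r', 0 < r' < r -> level u r' x) -> level u r x.
Proof.
move=> r0 H; rewrite level_gt0//= leNgt; apply/negP => uxr.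
have ux0 := fuzzy_ge0 u x.
have := H ((u x + r) / 2); rewrite level_gt0/=; last lra.
by move=> /(_ _); lra.
Qed.

(* Representation theorem: the images under a continuous map [f] of a family of
   nested compact sets are the level sets of a fuzzy number. *)
Lemma fuzzy_of_image (X : topologicalType) (K : R -> set X) (f : X -> R) :
  hausdorff_space X -> continuous f ->
  (forall r, 0 <= r <= 1 -> K r !=set0) ->
  (forall r, 0 <= r <= 1 -> compact (K r)) ->
  (forall r r', 0 <= r' <= r -> K r `<=` K r') ->
  (forall r x, 0 < r -> (forall r', 0 < r' < r -> K r' x) -> K r x) ->
  K 0 `<=` closure (\bigcup_(r in [set r | 0 < r <= 1]) K r) ->
  (forall r, 0 <= r <= 1 -> convex (f @` K r)) ->
  exists w : fuzzy, forall r, 0 <= r <= 1 -> level w r = f @` K r.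
Proof.
move=> hX cf K0 Kcpt Kmon Kleft Kcl Kconv.
pose S x : set R := [set r | 0 <= r <= 1 /\ (r = 0 \/ (f @` K r) x)].
have S0 x : S x 0 by split; [lra|left].
have Sub x : has_ubound (S x) by exists 1 => r [/andP[]].
have Ssup x : has_sup (S x) by split=> //; exists 0; exact: S0.
pose w x := sup (S x).
have w01 x : 0 <= w x <= 1.
  apply/andP; split; first exact: (ub_le_sup (Sub x) (S0 x)).
  by apply: ge_sup => [|r [/andP[]]//]; exists 0.
have wP r x : 0 < r <= 1 -> r <= w x <-> (f @` K r) x.
  move=> /andP[r0 r1]; split=> [rw|Kx]; last first.
    by apply: ub_le_sup => //; split; [lra|right].
  have Kx r' : 0 < r' < r -> exists2 y, K r' y & f y = x.
    move=> /andP[r'0 r'r].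
    have e0 : 0 < w x - r' by lra.
    have [s [s01 sx]] := sup_adherent e0 (Ssup x).
    rewrite subKr => r's; case: sx => [s0|[y Ky <-]]; first lra.
    by exists y => //; apply: Kmon Ky; lra.
  pose L r' := K r' `&` f @^-1` [set x].
  have Lcl r' : 0 < r' < r -> closed (L r').
    move=> r'r; apply: closedI.
      by apply: compact_closed => //; apply: Kcpt; lra.
    apply: preimage_closed; first by move=> ? _; exact: cf.
    exact: accessible_closed_set1 (hausdorff_accessible (@Rhausdorff R)) _.
  pose G := filter_from [set r' | 0 < r' < r] L.
  have GF : ProperFilter G.
    apply: filter_from_proper; last first.
      by move=> r' r'r; have [y Ky fy] := Kx _ r'r; exists y.
    apply: filter_from_filter; first by exists (r / 2) => /=; lra.
    move=> a b /= a0 b0; exists (Num.max a b).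
      by rewrite /= lt_max gt_max; lra.
    have ma : a <= Num.max a b by rewrite le_max lexx.
    have mb : b <= Num.max a b by rewrite le_max lexx orbT.
    by move=> y [Ky fy]; split; split=> //; apply: Kmon Ky; lra.
  have GK : G (K (r / 2)).
    by exists (r / 2) => /=; [lra|move=> y []].
  have r201 : 0 <= r / 2 <= 1 by lra.
  have [p [Kp cp]] := Kcpt _ r201 G GF GK.
  have Lp r' : 0 < r' < r -> L r' p.
    move=> r'r; apply: (Lcl _ r'r) => B Bp.
    by apply: cp => //; exists r'.
  exists p; first by apply: Kleft => // r' /Lp[].
  by have [|_ /=] := Lp (r / 2); first lra.
have w_gt0 : closure [set x | 0 < w x] = f @` K 0.
  apply/seteqP; split.
    have K0cl : closed (f @` K 0).
      apply: compact_closed; first exact: Rhausdorff.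
      apply: continuous_compact; last by apply: Kcpt; lra.
      exact: continuous_subspaceT.
    rewrite [X in _ `<=` X](closure_id _).1//; apply: closureS => x /= wx.
    have [|+ _] := wP (w x) x; first by have := w01 x; lra.
    move=> /(_ (lexx _))[y Ky <-]; exists y => //; apply: Kmon Ky; lra.
  move=> _ [y /Kcl Ky <-] B /cf By.
  have [z [[r /= r01 Kz] Bz]] := Ky _ By.
  exists (f z); split => //=.
  by have := (wP r (f z) r01).2 (imageP _ Kz); lra.
have wnorm : exists x0, w x0 = 1.
  have [|y Ky] := K0 1; first lra.
  exists (f y); have := w01 (f y).
  by have [|_ /(_ (imageP _ Ky))] := wP 1 (f y); first lra; lra.
have wconv : quasiconcave w.
  move=> x y l l01; set m := Num.min _ _.
  have [m0|m0] := leP m 0; first by have := w01 (l * x + (1 - l) * y); lra.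
  have mx : m <= w x by rewrite ge_min lexx.
  have my : m <= w y by rewrite ge_min lexx orbT.
  have m01 : 0 < m <= 1 by have := w01 x; lra.
  apply/(wP _ _ m01); apply: Kconv => //; [lra| |]; exact/(wP _ _ m01).
have wusc : upper_semicontinuous w.
  move=> x a wa.
  have [a1|a1] := ltP 1 a.
    by near=> y; have := w01 y; lra.
  have a01 : 0 < a <= 1 by have := w01 x; lra.
  have Kacl : closed (f @` K a).
    apply: compact_closed; first exact: Rhausdorff.
    apply: continuous_compact; last by apply: Kcpt; lra.
    exact: continuous_subspaceT.
  have := closed_openC Kacl; rewrite openE => /(_ x).
  have nKx : (~` (f @` K a)) x by move=> /(wP _ _ a01); lra.
  move=> /(_ nKx); apply: filterS => y nKy.
  by rewrite ltNge; apply/negP => /(wP _ _ a01).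
have wcpt : compact (closure [set x | 0 < w x]).
  rewrite w_gt0; apply: continuous_compact; last by apply: Kcpt; lra.
  exact: continuous_subspaceT.
exists (Fuzzy w01 wnorm wconv wusc wcpt) => r r01.
rewrite /level; case: ifPn => r0 /=.
  by apply/seteqP; split=> x /=; apply wP; lra.
by rewrite w_gt0 (_ : r = 0)//; lra.
Unshelve. all: by end_near.
Qed.

Lemma level0_bigcup (u : fuzzy) :
  level u 0 `<=` closure (\bigcup_(r in [set r | 0 < r <= 1]) level u r).
Proof.
rewrite level0; apply: closureS => x /= u0.
by exists (u x); rewrite /= ?u0 ?fuzzy_le1// level_gt0/=.
Qed.

Lemma fuzzy_add_ex (u v : fuzzy) : exists w : fuzzy,
  forall r, 0 <= r <= 1 ->
    level w r = [set x + y | x in level u r & y in level v r].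
Proof.
have [||||||||w wE] := @fuzzy_of_image (R * R)%type
  (fun r => level u r `*` level v r) (fun p => p.1 + p.2).
- exact: (@norm_hausdorff R (R * R)%type).
- move=> p; apply: (@cvgD _ _ _ _ _ fst snd); [exact: cvg_fst|exact: cvg_snd].
- move=> r /andP[_ r1].
  have [x ux] := @level_neq0 u r r1; have [y vy] := @level_neq0 v r r1.
  by exists (x, y).
- by move=> r /andP[r0 _]; apply: compact_setX; exact: level_compact.
- by move=> r r' rr' [x y] [/= ux vy]; split; exact: level_nonincr rr' _ _.
- by move=> r [x y] r0 H; split; apply: level_left => // r' /H[].
- move=> [x y] [/= /level0_bigcup ux /level0_bigcup vy] B [[V W]/= [Vx Wy] VW].
  have [a [[r /= r01 ua] Va]] := ux _ Vx.
  have [b [[q /= q01 vb] Wb]] := vy _ Wy.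
  exists (a, b); split; last exact: VW.
  exists (Num.min r q); first by rewrite /= lt_min ge_min; lra.
  have mr : Num.min r q <= r by rewrite ge_min lexx.
  have mq : Num.min r q <= q by rewrite ge_min lexx orbT.
  have m0 : 0 <= Num.min r q by rewrite le_min; lra.
  by split; [apply: level_nonincr ua|apply: level_nonincr vb]; rewrite m0.
- move=> r r01 _ _ l [[x y] /= [ux vy] <-] [[x' y'] /= [ux' vy'] <-] l01.
  exists (l * x + (1 - l) * x', l * y + (1 - l) * y') => /=; last lra.
  by split; apply: level_convex.
exists w => r /wE ->; apply/seteqP; split.
  by move=> _ [[x y] /= [ux vy] <-]; exists x => //; exists y.
by move=> _ [x ux [y vy <-]]; exists (x, y).
Qed.

Lemma fuzzy_scale_ex (c : R) (u : fuzzy) : exists w : fuzzy,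
  forall r, 0 <= r <= 1 -> level w r = [set c * x | x in level u r].
Proof.
apply: (@fuzzy_of_image R (level u) (fun x => c * x)).
- exact: Rhausdorff.
- exact: mulrl_continuous.
- by move=> r /andP[_]; exact: level_neq0.
- by move=> r /andP[r0 _]; exact: level_compact.
- exact: level_nonincr.
- exact: level_left.
- exact: level0_bigcup.
- move=> r r01 _ _ l [x ux <-] [y uy <-] l01.
  by exists (l * x + (1 - l) * y); [exact: level_convex|lra].
Qed.

Definition fuzzy_add (u v : fuzzy) : fuzzy := sval (cid (fuzzy_add_ex u v)).
Definition fuzzy_scale (c : R) (u : fuzzy) : fuzzy :=
  sval (cid (fuzzy_scale_ex c u)).

Lemma level_add (u v : fuzzy) r : 0 <= r <= 1 ->
  level (fuzzy_add u v) r = [set x + y | x in level u r & y in level v r].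
Proof. by move=> r01; rewrite /fuzzy_add; case: cid => w /= ->. Qed.

Lemma level_scale c (u : fuzzy) r : 0 <= r <= 1 ->
  level (fuzzy_scale c u) r = [set c * x | x in level u r].
Proof. by move=> r01; rewrite /fuzzy_scale; case: cid => w /= ->. Qed.

Lemma levelE (u : fuzzy) r : 0 <= r <= 1 ->
  level u r = `[level_inf u r, level_sup u r]%classic.
Proof.
move=> /andP[r0 r1]; have n0 := @level_neq0 u r r1.
have [M [_ MP]] := compact_bounded (@level_compact u r r0).
have bd x : level u r x -> `|x| <= M + 1 by apply: (MP (M + 1)); lra.
have hu : has_ubound (level u r).
  by exists (M + 1) => x /bd; apply: le_trans; exact: ler_norm.
have hl : has_lbound (level u r).
  by exists (- (M + 1)) => x /bd; rewrite ler_norml => /andP[].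
have li : level u r (level_inf u r).
  rewrite [X in X _](closure_id _).1; last exact: level_closed.
  move=> B /nbhs_ballP[e /= e0 eB].
  have [x ux xe] := inf_adherent e0 (conj n0 hl).
  exists x; split=> //; apply: eB; rewrite /ball/= ltr_distlC -/(level_inf u r).
  by have := ge_inf hl ux; rewrite -/(level_inf u r); lra.
have ls : level u r (level_sup u r).
  rewrite [X in X _](closure_id _).1; last exact: level_closed.
  exact: closure_sup.
apply/seteqP; split=> x /=; rewrite in_itv/=.
  by move=> ux; rewrite ge_inf// ub_le_sup.
move=> /andP[ix xs].
have [e|ne] := eqVneq (level_inf u r) (level_sup u r).
  by rewrite (_ : x = level_inf u r)//; apply/le_anti; rewrite ix andbT e.
have d0 : 0 < level_sup u r - level_inf u r.
  by rewrite subr_gt0 lt_neqAle ne (le_trans ix xs).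
have := @level_convex u r _ _
  ((x - level_inf u r) / (level_sup u r - level_inf u r)) ls li.
rewrite divr_ge0 ?subr_ge0//; last exact: le_trans xs.
rewrite ler_pdivrMr// mul1r lerD2r xs => /(_ isT).
congr (level u r _); field; lra.
Qed.

Lemma level_bounds (u : fuzzy) r : 0 <= r <= 1 ->
  [/\ level_inf u 0 <= level_inf u r, level_inf u r <= level_sup u r
     & level_sup u r <= level_sup u 0].
Proof.
move=> r01; have /andP[r0 r1] := r01.
have [x] := @level_neq0 u r r1.
rewrite (levelE u r01) /= in_itv/= => /andP[ix xs].
have isr := le_trans ix xs.
have sub : level u r `<=` level u 0 by apply: level_nonincr; rewrite lexx.
have h0 : 0 <= (0 : R) <= 1 by lra.
rewrite (levelE u r01) (levelE u h0) in sub.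
have := sub (level_inf u r); have := sub (level_sup u r).
rewrite /= !in_itv/= !lexx isr => /(_ isT)/andP[_ ?] /(_ isT)/andP[? _].
by split.
Qed.

Lemma Dinf_has_sup (u v : fuzzy) :
  has_sup [set Num.max `|level_inf u r - level_inf v r|
                       `|level_sup u r - level_sup v r| | r in `[0, 1]%classic].
Proof.
split; first by eexists; exists 0; rewrite //= in_itv/=; lra.
pose M := Num.max (level_sup u 0 - level_inf v 0)
                  (level_sup v 0 - level_inf u 0).
have M1 : level_sup u 0 - level_inf v 0 <= M by rewrite le_max lexx.
have M2 : level_sup v 0 - level_inf u 0 <= M by rewrite le_max lexx orbT.
exists M => x [r /=]; rewrite in_itv/= => r01 <-.
have [? ? ?] := level_bounds u r01; have [? ? ?] := level_bounds v r01.
by rewrite ge_max !ler_norml; lra.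
Qed.

(* A relation, since the difference need not exist; at most one [w] qualifies. *)
Definition is_gHdiff (u v w : fuzzy) : Prop :=
  u = fuzzy_add v w \/ v = fuzzy_add u (fuzzy_scale (-1) w).

End FuzzyNumber.

Arguments fuzzy R : clear implicits.

Section Derivative.
Context {R : realType}.
Implicit Types (T : set R) (f : R -> fuzzy R) (s : R) (d : fuzzy R).

(* A map from [T] to fuzzy numbers is represented by a function on [R] whose
   values outside [T] are irrelevant: below, [f] is only evaluated at points
   [t] of [T] and at [sigma T s], [rho T s], which lie in [T] when [s] does. *)

Definition is_Delta_gH T f s d : Prop :=
  forall e, 0 < e -> exists2 delta, 0 < delta &
  forall t, s - delta < t < s + delta -> T t ->
  exists w, is_gHdiff (f (sigma T s)) (f t) w /\
    Dinf w (fuzzy_scale (mu T s t) d) <= e * `|mu T s t|.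

Definition is_nabla_gH T f s d : Prop :=
  forall e, 0 < e -> exists2 delta, 0 < delta &
  forall t, s - delta < t < s + delta -> T t ->
  exists w, is_gHdiff (f t) (f (rho T s)) w /\
    Dinf w (fuzzy_scale (nu T s t) d) <= e * `|nu T s t|.

Definition is_diamond_gH (alpha : R) T f s d : Prop :=
  forall e, 0 < e -> exists2 delta, 0 < delta &
  forall t, s - delta < t < s + delta -> T t ->
  exists w1 w2,
    [/\ is_gHdiff (f (sigma T s)) (f t) w1,
        is_gHdiff (f t) (f (rho T s)) w2 &
        Dinf (fuzzy_add (fuzzy_scale (alpha * nu T s t) w1)
                        (fuzzy_scale ((1 - alpha) * mu T s t) w2))
             (fuzzy_scale (mu T s t * nu T s t) d)
          <= e * `|mu T s t * nu T s t| ].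

Definition Delta_gH_differentiable T f s : Prop :=
  exists d, is_Delta_gH T f s d.

Definition nabla_gH_differentiable T f s : Prop :=
  exists d, is_nabla_gH T f s d.

Definition diamond_gH_differentiable (alpha : R) T f s : Prop :=
  exists d, is_diamond_gH alpha T f s d.

End Derivative.

(* Main.v *)
Require Import Defs.
From mathcomp Require Import all_boot all_order all_algebra.
From mathcomp Require Import all_classical all_reals all_analysis.
From mathcomp Require Import ring lra.
Import Order.TTheory GRing.Theory Num.Theory numFieldNormedType.Exports.
Local Open Scope classical_set_scope.
Local Open Scope ring_scope.

(** Write [w1 t] for the difference of [f (sigma s)] and [f t], [w2 t] for that
    of [f t] and [f (rho s)], and [a = mu_st], [b = nu_st].  The diamond
    derivative controls [alpha b w1 + (1 - alpha) a w2 - a b d] by [e |a b|],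
    whereas the conclusion asks that [w1 / a] and [w2 / b] converge separately
    as [t] tends to [s] in the time scale.

    If [sigma s = rho s = s], then [b = - a] and [w2 = - w1], so [w1 / a] and
    [w2 / b] are the same fuzzy number; a convex combination of an interval
    with itself is that interval, and both derivatives are [d]
    ([has_diamond_rate_opp]).

    Otherwise one of the two steps, say [a], has a nonzero limit [a0].  Then
    - [f] is continuous at [s] along the time scale ([diamond_cont]).  If [s] is
      isolated this is trivial; if [b] tends to zero, the diamond estimate
      bounds [(1 - alpha) |a| |w2|] by a multiple of [|b|], since [|w1|] is at
      most a constant plus [|w2|] ([diamond_rate_norm_cvg0]);
    - hence [w1] converges and so does [w1 / a] ([has_rate_of_cvg]);
    - subtracting this from the diamond estimate divided by [a b] leaves
      [alpha g + (1 - alpha) (w2 / b)] close to [d], where [g = lim w1 / a].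
      Addition of fuzzy numbers has no inverse, so the limit of [w2 / b] must be
      shown to exist: the translates [v + z] of a fixed [v] form a closed set
      for the metric ([hukuhara_closed]), hence [d = alpha g + (1 - alpha) d']
      for some [d'], and addition of [alpha g] is an isometry
      ([has_rate_companion]).
    The case where only [b] has a nonzero limit is the same after exchanging
    the roles of the two differences. *)

Set Implicit Arguments.
Unset Strict Implicit.
Unset Printing Implicit Defensive.

Local Notation "u [+] v" := (fuzzy_add u v) (at level 50, left associativity).
Local Notation "c [*] u" := (fuzzy_scale c u) (at level 40, left associativity).

(** * Endpoint calculus for level sets *)

Section LevelEndpoints.
Context {R : realType}.
Implicit Types (u v w : fuzzy R) (r c e : R).

Lemma level_itvP u r x : 0 <= r <= 1 ->
  level u r x <-> level_inf u r <= x <= level_sup u r.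
Proof. by move=> r01; rewrite levelE//= in_itv. Qed.

Lemma level_inf_le_sup u r : 0 <= r <= 1 -> level_inf u r <= level_sup u r.
Proof. by case/(level_bounds u). Qed.

Lemma level_inf_sup_unique u r a b : 0 <= r <= 1 -> a <= b ->
  (forall x, level u r x <-> a <= x <= b) ->
  level_inf u r = a /\ level_sup u r = b.
Proof.
move=> r01 ab H; have u01 := level_inf_le_sup u r01.
have E x : (level_inf u r <= x <= level_sup u r) <-> (a <= x <= b).
  by rewrite -H level_itvP.
have := (E a).2; have := (E b).2; have := (E (level_inf u r)).1.
have := (E (level_sup u r)).1; rewrite !lexx ab u01.
by move=> /(_ isT)? /(_ isT)? /(_ isT)? /(_ isT)?; lra.
Qed.

Lemma level_inf_sup_add u v r : 0 <= r <= 1 ->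
  level_inf (u [+] v) r = level_inf u r + level_inf v r /\
  level_sup (u [+] v) r = level_sup u r + level_sup v r.
Proof.
move=> r01; have u01 := level_inf_le_sup u r01.
have v01 := level_inf_le_sup v r01.
apply: level_inf_sup_unique => //; first exact: lerD.
move=> x; rewrite level_add//; split.
  by move=> [y /(level_itvP u y r01) ? [z /(level_itvP v z r01) ? <-]]; lra.
move=> xuv; have [h|h] := leP (x - level_inf u r) (level_sup v r).
  exists (level_inf u r); first by apply/level_itvP => //; lra.
  by exists (x - level_inf u r); [apply/level_itvP => //; lra|lra].
exists (x - level_sup v r); first by apply/level_itvP => //; lra.
by exists (level_sup v r); [apply/level_itvP => //; lra|lra].
Qed.

Lemma level_inf_add u v r : 0 <= r <= 1 ->
  level_inf (u [+] v) r = level_inf u r + level_inf v r.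
Proof. by case/(level_inf_sup_add u v). Qed.

Lemma level_sup_add u v r : 0 <= r <= 1 ->
  level_sup (u [+] v) r = level_sup u r + level_sup v r.
Proof. by case/(level_inf_sup_add u v). Qed.

Lemma level_inf_sup_scale_ge0 c u r : 0 <= c -> 0 <= r <= 1 ->
  level_inf (c [*] u) r = c * level_inf u r /\
  level_sup (c [*] u) r = c * level_sup u r.
Proof.
move=> c0 r01; have u01 := level_inf_le_sup u r01.
apply: level_inf_sup_unique => //; first exact: ler_wpM2l.
move=> x; rewrite level_scale//; split.
  by move=> [y /(level_itvP u y r01)/andP[? ?] <-]; rewrite !ler_wpM2l.
have [->|cN0] := eqVneq c 0.
  rewrite !mul0r => /le_anti <-; exists (level_inf u r); last by rewrite mul0r.
  by apply/level_itvP; rewrite ?lexx.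
have {cN0}c0 : 0 < c by rewrite lt_neqAle eq_sym cN0.
move=> xu; exists (x / c); last by rewrite mulrC divfK ?gt_eqF.
apply/level_itvP => //.
by rewrite ler_pdivlMr// ler_pdivrMr// mulrC (mulrC _ c).
Qed.

Lemma level_inf_sup_scale_le0 c u r : c <= 0 -> 0 <= r <= 1 ->
  level_inf (c [*] u) r = c * level_sup u r /\
  level_sup (c [*] u) r = c * level_inf u r.
Proof.
move=> c0 r01; have u01 := level_inf_le_sup u r01.
apply: level_inf_sup_unique => //; first exact: ler_wnM2l.
move=> x; rewrite level_scale//; split.
  by move=> [y /(level_itvP u y r01)/andP[? ?] <-]; rewrite !ler_wnM2l.
have [->|cN0] := eqVneq c 0.
  rewrite !mul0r => /le_anti <-; exists (level_inf u r); last by rewrite mul0r.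
  by apply/level_itvP; rewrite ?lexx.
have {cN0}c0 : c < 0 by rewrite lt_neqAle cN0.
move=> xu; exists (x / c); last by rewrite mulrC divfK ?lt_eqF.
apply/level_itvP => //.
by rewrite ler_ndivlMr// ler_ndivrMr// mulrC (mulrC _ c) andbC.
Qed.

Lemma level_inf_scale c u r : 0 <= r <= 1 -> level_inf (c [*] u) r =
  if 0 <= c then c * level_inf u r else c * level_sup u r.
Proof.
move=> r01; case: leP => c0.
  by have [] := level_inf_sup_scale_ge0 u c0 r01.
by have [] := level_inf_sup_scale_le0 u (ltW c0) r01.
Qed.

Lemma level_sup_scale c u r : 0 <= r <= 1 -> level_sup (c [*] u) r =
  if 0 <= c then c * level_sup u r else c * level_inf u r.
Proof.
move=> r01; case: leP => c0.
  by have [] := level_inf_sup_scale_ge0 u c0 r01.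
by have [] := level_inf_sup_scale_le0 u (ltW c0) r01.
Qed.

Lemma fuzzy_eq_endpoints u v :
  (forall r, 0 <= r <= 1 ->
     level_inf u r = level_inf v r /\ level_sup u r = level_sup v r) -> u = v.
Proof.
move=> uv; apply: level_ext => r r01.
by rewrite !levelE//; case: (uv r r01) => -> ->.
Qed.

Lemma level_inf_mono u r r' : 0 <= r' <= r -> r <= 1 ->
  level_inf u r' <= level_inf u r.
Proof.
move=> rr' r1; have r01 : 0 <= r <= 1 by lra.
have := level_inf_le_sup u r01 => ?.
have : level u r (level_inf u r) by apply/level_itvP => //; rewrite lexx.
have r'01 : 0 <= r' <= 1 by lra.
by move=> /(level_nonincr rr')/(level_itvP u _ r'01)/andP[].
Qed.

Lemma level_sup_anti u r r' : 0 <= r' <= r -> r <= 1 ->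
  level_sup u r <= level_sup u r'.
Proof.
move=> rr' r1; have r01 : 0 <= r <= 1 by lra.
have := level_inf_le_sup u r01 => ?.
have : level u r (level_sup u r) by apply/level_itvP => //; rewrite lexx andbT.
have r'01 : 0 <= r' <= 1 by lra.
by move=> /(level_nonincr rr')/(level_itvP u _ r'01)/andP[].
Qed.

Lemma fuzzy_addC u v : u [+] v = v [+] u.
Proof.
apply: fuzzy_eq_endpoints => r r01.
by rewrite !(level_inf_add, level_sup_add)//; lra.
Qed.

Lemma fuzzy_scale1 u : 1 [*] u = u.
Proof.
apply: fuzzy_eq_endpoints => r r01.
by rewrite !(level_inf_scale, level_sup_scale)// ler01 !mul1r.
Qed.

Lemma fuzzy_scaleA c c' u : c [*] (c' [*] u) = (c * c') [*] u.
Proof.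
apply: level_ext => r r01; rewrite !level_scale//; apply/seteqP; split=> x.
  by move=> [_ [y uy <-] <-]; exists y => //; rewrite mulrA.
by move=> [y uy <-]; exists (c' * y); [exists y|rewrite mulrA].
Qed.

Lemma fuzzy_scaleDr c u v : c [*] (u [+] v) = c [*] u [+] c [*] v.
Proof.
apply: fuzzy_eq_endpoints => r r01.
rewrite !(level_inf_scale, level_sup_scale, level_inf_add, level_sup_add)//.
by case: ifP => _; lra.
Qed.

Lemma fuzzy_scaleDl c c' u : 0 <= c -> 0 <= c' ->
  c [*] u [+] c' [*] u = (c + c') [*] u.
Proof.
move=> c0 c'0; apply: fuzzy_eq_endpoints => r r01.
rewrite !(level_inf_add, level_sup_add)// !(level_inf_scale, level_sup_scale)//.
by rewrite c0 c'0 addr_ge0//; lra.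
Qed.

Lemma fuzzy_scale0 u v : 0 [*] u = 0 [*] v.
Proof.
apply: fuzzy_eq_endpoints => r r01.
by rewrite !(level_inf_scale, level_sup_scale)// lexx !mul0r.
Qed.

Lemma fuzzy_add0 u v : u [+] 0 [*] v = u.
Proof.
rewrite (fuzzy_scale0 v u) -{1}(fuzzy_scale1 u).
by rewrite fuzzy_scaleDl ?addr0 ?fuzzy_scale1.
Qed.

(** * The supremum metric *)

Lemma Dinf_leP u v e : Dinf u v <= e <-> forall r, 0 <= r <= 1 ->
  `|level_inf u r - level_inf v r| <= e /\
  `|level_sup u r - level_sup v r| <= e.
Proof.
have hs := Dinf_has_sup u v; split=> [De r r01|H].
  have : Num.max `|level_inf u r - level_inf v r|
      `|level_sup u r - level_sup v r| <= e.
    apply: le_trans De; apply: ub_le_sup; first exact: hs.2.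
    by exists r; rewrite //= in_itv.
  by rewrite ge_max => /andP.
apply: ge_sup; first exact: hs.1.
move=> x [r /=]; rewrite in_itv/= => r01 <-.
by rewrite ge_max; apply/andP; exact: H.
Qed.

Lemma Dinf_ge u v r : 0 <= r <= 1 ->
  `|level_inf u r - level_inf v r| <= Dinf u v /\
  `|level_sup u r - level_sup v r| <= Dinf u v.
Proof. by move=> r01; apply: (Dinf_leP u v _).1. Qed.

Lemma Dinf_ge0 u v : 0 <= Dinf u v.
Proof.
have r01 : 0 <= (0 : R) <= 1 by lra.
by have [+ _] := Dinf_ge u v r01; apply: le_trans.
Qed.

Lemma Dinf_refl u : Dinf u u = 0.
Proof.
apply/le_anti; rewrite Dinf_ge0 andbT.
by apply/Dinf_leP => r r01; rewrite !subrr normr0.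
Qed.

Lemma Dinf_sym u v : Dinf u v = Dinf v u.
Proof.
suff le (x y : fuzzy R) : Dinf x y <= Dinf y x by apply/le_anti; rewrite !le.
apply/Dinf_leP => r r01; rewrite distrC (distrC (level_sup x r)).
exact: Dinf_ge.
Qed.

Lemma Dinf_triangle v u w : Dinf u w <= Dinf u v + Dinf v w.
Proof.
apply/Dinf_leP => r r01; have [u1 u2] := Dinf_ge u v r01.
have [v1 v2] := Dinf_ge v w r01.
by split; [apply: le_trans (ler_distD (level_inf v r) _ _) _
          |apply: le_trans (ler_distD (level_sup v r) _ _) _]; exact: lerD.
Qed.

(** Endpoints add, so a common summand cancels: in the metric, addition behaves
    as in a group although it has no inverse. *)
Lemma Dinf_addl v u w : Dinf (v [+] u) (v [+] w) = Dinf u w.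
Proof.
have E (a b c : R) : a + b - (a + c) = b - c by ring.
apply/le_anti/andP; split; apply/Dinf_leP => r r01.
  by rewrite !(level_inf_add, level_sup_add)// !E; exact: Dinf_ge.
have := Dinf_ge (v [+] u) (v [+] w) r01.
by rewrite !(level_inf_add, level_sup_add)// !E.
Qed.

Lemma Dinf_scale c u v : Dinf (c [*] u) (c [*] v) = `|c| * Dinf u v.
Proof.
have le d (x y : fuzzy R) : Dinf (d [*] x) (d [*] y) <= `|d| * Dinf x y.
  apply/Dinf_leP => r r01; have [? ?] := Dinf_ge x y r01.
  rewrite !(level_inf_scale, level_sup_scale)//.
  by case: ifP => _; rewrite -!mulrBr !normrM !ler_wpM2l.
apply/le_anti; rewrite le/=; have [->|c0] := eqVneq c 0.
  by rewrite normr0 mul0r Dinf_ge0.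
rewrite -ler_pdivlMl ?normr_gt0// -normfV; apply: le_trans (le _ _ _).
by rewrite !fuzzy_scaleA mulVf// !fuzzy_scale1.
Qed.

(** The crisp number zero is [0 [*] u], whatever [u] is ([fuzzy_scale0]), so
    this is the distance of [u] to zero. *)
Definition fuzzy_norm u : R := Dinf u (0 [*] u).

Lemma fuzzy_normE u v : fuzzy_norm u = Dinf u (0 [*] v).
Proof. by rewrite /fuzzy_norm (fuzzy_scale0 u v). Qed.

Lemma fuzzy_norm_scale c u : fuzzy_norm (c [*] u) = `|c| * fuzzy_norm u.
Proof.
rewrite (fuzzy_normE _ u) -Dinf_scale fuzzy_scaleA mulr0.
by congr Dinf; exact: fuzzy_scale0.
Qed.

Lemma fuzzy_norm_le_Dinf u v : fuzzy_norm u <= Dinf u v + fuzzy_norm v.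
Proof. by rewrite (fuzzy_normE u v); exact: Dinf_triangle. Qed.

Lemma fuzzy_norm_ge u r : 0 <= r <= 1 ->
  `|level_inf u r| <= fuzzy_norm u /\ `|level_sup u r| <= fuzzy_norm u.
Proof.
move=> r01; have := Dinf_ge u (0 [*] u) r01.
by rewrite level_inf_scale// level_sup_scale// lexx !mul0r !subr0.
Qed.

Lemma Dinf_addr_norm u v : Dinf u (v [+] u) = fuzzy_norm v.
Proof.
rewrite fuzzy_addC -{1}(fuzzy_add0 u v) Dinf_addl Dinf_sym.
by rewrite -fuzzy_normE.
Qed.

Lemma Dinf_scalel c c' u :
  Dinf (c [*] u) (c' [*] u) <= `|c - c'| * fuzzy_norm u.
Proof.
apply/Dinf_leP => r r01; have [? ?] := fuzzy_norm_ge u r01.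
rewrite !(level_inf_scale, level_sup_scale)//.
have same x : `|x| <= fuzzy_norm u ->
    `|c * x - c' * x| <= `|c - c'| * fuzzy_norm u.
  by move=> ?; rewrite -mulrBl normrM ler_wpM2l.
(* Scalars of opposite signs exchange the endpoints, but then the distance of
   the scalars is the sum of their absolute values. *)
have opp x y : `|x| <= fuzzy_norm u -> `|y| <= fuzzy_norm u ->
    c' <= 0 <= c \/ c <= 0 <= c' ->
    `|c * x - c' * y| <= `|c - c'| * fuzzy_norm u.
  move=> ? ? cc'; apply: le_trans (ler_normB _ _) _; rewrite !normrM.
  have -> : `|c - c'| = `|c| + `|c'|.
    case: cc' => /andP[? ?].
      by rewrite (ger0_norm (_ : 0 <= c)) ?(ler0_norm (_ : c' <= 0)) ?ger0_norm; lra.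
    by rewrite (ler0_norm (_ : c <= 0)) ?(ger0_norm (_ : 0 <= c')) ?ler0_norm; lra.
  by rewrite mulrDl lerD// ler_wpM2l.
case: ifPn => c0; case: ifPn => c'0; split; try exact: same;
  by apply: opp => //; lra.
Qed.

End LevelEndpoints.


(** * The generalized Hukuhara difference *)

Section GHDifference.
Context {R : realType}.
Implicit Types (u v w : fuzzy R) (r c e : R).

(** The two clauses of the definition say whether the endpoint differences [a]
    and [b] come in increasing or decreasing order; the level set of the
    difference is the interval between them in both cases. *)
Lemma gHdiff_endpoints u v w r : is_gHdiff u v w -> 0 <= r <= 1 ->
  let a := level_inf u r - level_inf v r in
  let b := level_sup u r - level_sup v r in
  level_inf w r = Num.min a b /\ level_sup w r = Num.max a b.
Proof.
move=> uvw r01 /=; have := level_inf_le_sup w r01.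
case: uvw => -> ; rewrite level_inf_add// level_sup_add//.
  have E (x y : R) : x + y - x = y by ring.
  rewrite !E => le.
  by split; [rewrite min_l|rewrite max_r].
rewrite level_inf_scale// level_sup_scale// ler0N1 !mulN1r !subKr => le.
by split; [rewrite min_r|rewrite max_l].
Qed.

Lemma is_gHdiff_unique u v w w' : is_gHdiff u v w -> is_gHdiff u v w' -> w = w'.
Proof.
move=> uvw uvw'; apply: fuzzy_eq_endpoints => r r01.
have [-> ->] := gHdiff_endpoints uvw r01.
by have [-> ->] := gHdiff_endpoints uvw' r01.
Qed.

(** A total version of the difference; the value [u] is a placeholder for when
    the difference does not exist. *)
Definition gHdiff u v : fuzzy R :=
  if pselect (exists w, is_gHdiff u v w) is left ex then sval (cid ex) else u.

Lemma gHdiffE u v w : is_gHdiff u v w -> gHdiff u v = w.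
Proof.
move=> uvw; rewrite /gHdiff; case: pselect => [ex|[]]; last by exists w.
by apply: is_gHdiff_unique uvw; exact: svalP (cid ex).
Qed.

Lemma is_gHdiff_opp u v w : is_gHdiff u v w -> is_gHdiff v u (-1 [*] w).
Proof.
case=> H; [right|left] => //.
by rewrite fuzzy_scaleA mulrNN mulr1 fuzzy_scale1.
Qed.

Lemma fuzzy_norm_gHdiff u v w : is_gHdiff u v w -> fuzzy_norm w = Dinf u v.
Proof.
case=> ->; rewrite fuzzy_addC; first by rewrite Dinf_sym Dinf_addr_norm.
by rewrite Dinf_addr_norm fuzzy_norm_scale normrN1 mul1r.
Qed.

Lemma Dinf_gHdiff_le u v w u' v' w' : is_gHdiff u v w -> is_gHdiff u' v' w' ->
  Dinf w w' <= Dinf u u' + Dinf v v'.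
Proof.
move=> uvw uvw'; apply/Dinf_leP => r r01.
have [-> ->] := gHdiff_endpoints uvw r01.
have [-> ->] := gHdiff_endpoints uvw' r01.
have [iu su] := Dinf_ge u u' r01; have [iv sv] := Dinf_ge v v' r01.
move: iu su iv sv; rewrite !ler_norml !minEle !maxEle.
by do 2 case: ifP => /= ?; lra.
Qed.

End GHDifference.

(** * Translates of a fuzzy number form a closed set *)

Section HukuharaClosed.
Context {R : realType}.
Implicit Types (u v w : fuzzy R) (r e : R).

(** Otherwise the point [level_inf u r - e] would lie in all level sets of
    smaller positive index, hence in their intersection [level u r]. *)
Lemma level_inf_left_cont u r e : 0 < r <= 1 -> 0 < e ->
  exists2 r0, 0 < r0 < r &
    forall r', r0 <= r' <= r -> level_inf u r - e <= level_inf u r'.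
Proof.
move=> r01 e0; apply: contrapT => H.
suff : level u r (level_inf u r - e).
  have r01' : 0 <= r <= 1 by lra.
  by move=> /(level_itvP u _ r01'); lra.
apply: level_left; first by lra.
move=> r0 r0r; have r001 : 0 <= r0 <= 1 by lra.
have r0r' : 0 <= r0 <= r by lra.
apply/level_itvP => //; apply/andP; split.
  rewrite leNgt; apply/negP => lt; apply: H; exists r0 => // r' r'r.
  apply: ltW; apply: lt_le_trans lt _; apply: level_inf_mono; lra.
have r01' : 0 <= r <= 1 by lra.
have := level_inf_le_sup u r01'; have := level_sup_anti u r0r'; lra.
Qed.

(** As [level u 0] is the closure of the set where [u] is positive, there is a
    point [y] near its infimum with [u y > 0]; that point lies in [level u r']
    for all [r' <= u y]. *)
Lemma level_inf_right_cont0 u e : 0 < e ->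
  exists2 r0, 0 < r0 <= 1 &
    forall r', 0 <= r' <= r0 -> level_inf u r' <= level_inf u 0 + e.
Proof.
move=> e0; have z01 : 0 <= (0 : R) <= 1 by lra.
have : level u 0 (level_inf u 0).
  by apply/level_itvP => //; rewrite lexx level_inf_le_sup.
rewrite level0 => /(_ (ball (level_inf u 0) e)).
move=> /(_ (nbhsx_ballx _ _ e0))[y [/= y0 ye]].
have y1 := fuzzy_le1 u y; exists (u y); first by rewrite y0.
move=> r' r'y; apply: (@le_trans _ _ (level_inf u (u y))).
  exact: level_inf_mono.
have uy01 : 0 <= u y <= 1 by rewrite fuzzy_ge0.
have /(level_itvP u _ uy01) : level u (u y) y by rewrite level_gt0/=.
by move: ye; rewrite /ball/= ltr_norml; lra.
Qed.

Lemma level_sup_opp u r : 0 <= r <= 1 ->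
  level_sup u r = - level_inf (-1 [*] u) r.
Proof. by move=> r01; rewrite level_inf_scale// ler0N1 mulN1r opprK. Qed.

Lemma level_sup_left_cont u r e : 0 < r <= 1 -> 0 < e ->
  exists2 r0, 0 < r0 < r &
    forall r', r0 <= r' <= r -> level_sup u r' <= level_sup u r + e.
Proof.
move=> r01 e0; have [r0 r0r H] := level_inf_left_cont (-1 [*] u) r01 e0.
exists r0 => // r' r'r; rewrite !level_sup_opp; last 2 first; [lra|lra|].
by have := H r' r'r; lra.
Qed.

Lemma level_sup_right_cont0 u e : 0 < e ->
  exists2 r0, 0 < r0 <= 1 &
    forall r', 0 <= r' <= r0 -> level_sup u 0 - e <= level_sup u r'.
Proof.
move=> e0; have [r0 r0r H] := level_inf_right_cont0 (-1 [*] u) e0.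
exists r0 => // r' r'r; rewrite !level_sup_opp; last 2 first; [lra|lra|].
by have := H r' r'r; lra.
Qed.

(** The level sets of the missing summand can only be the intervals with
    endpoints [lo r] and [hi r], the differences of the endpoints of [u] and [v].
    The approximate summands [z] show that these intervals are nonempty and
    nested, as such weak inequalities pass to uniform limits.  The one-sided
    semicontinuity required of a family of level sets is inherited from the
    endpoints of [u], those of [v] moving in the favourable direction by
    monotonicity. *)
Lemma hukuhara_closed u v :
  (forall e, 0 < e -> exists z, Dinf (v [+] z) u <= e) ->
  exists z, u = v [+] z.
Proof.
move=> H.
pose lo r := level_inf u r - level_inf v r.
pose hi r := level_sup u r - level_sup v r.
have approx e : 0 < e -> exists z : fuzzy R, forall r, 0 <= r <= 1 ->
    lo r - e <= level_inf z r <= lo r + e /\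
    hi r - e <= level_sup z r <= hi r + e.
  move=> /H[z /Dinf_leP vzu]; exists z => r r01; have := vzu r r01.
  rewrite level_inf_add// level_sup_add// !ler_norml /lo /hi; lra.
have lo_hi r : 0 <= r <= 1 -> lo r <= hi r.
  move=> r01; apply/ler_addgt0Pr => e e0.
  have e2 : 0 < e / 2 by lra.
  have [z /(_ r r01)] := approx _ e2; have := level_inf_le_sup z r01; lra.
have lo_mono r r' : 0 <= r' <= r -> r <= 1 -> lo r' <= lo r.
  move=> rr' r1; apply/ler_addgt0Pr => e e0.
  have e2 : 0 < e / 2 by lra.
  have [z zE] := approx _ e2; have r01 : 0 <= r <= 1 by lra.
  have r'01 : 0 <= r' <= 1 by lra.
  have := level_inf_mono z rr' r1; have := zE _ r01; have := zE _ r'01; lra.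
have hi_anti r r' : 0 <= r' <= r -> r <= 1 -> hi r <= hi r'.
  move=> rr' r1; apply/ler_addgt0Pr => e e0.
  have e2 : 0 < e / 2 by lra.
  have [z zE] := approx _ e2; have r01 : 0 <= r <= 1 by lra.
  have r'01 : 0 <= r' <= 1 by lra.
  have := level_sup_anti z rr' r1; have := zE _ r01; have := zE _ r'01; lra.
(* The image construction asks for nestedness at all indices, so the family is
   continued by the empty set above 1. *)
pose K r : set R := if r <= 1 then [set x | lo r <= x <= hi r] else set0.
have KE r : r <= 1 -> K r = [set x | lo r <= x <= hi r] by rewrite /K => ->.
have [||||||||w wE] := @fuzzy_of_image R R K id.
- exact: Rhausdorff.
- by move=> x; exact: cvg_id.
- move=> r /[dup] r01 /andP[_ r1]; exists (lo r).
  by rewrite KE//= lexx lo_hi.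
- move=> r /andP[_ r1]; rewrite KE//.
  have -> : [set x | lo r <= x <= hi r] = `[lo r, hi r]%classic.
    by apply/seteqP; split=> x /=; rewrite in_itv.
  exact: segment_compact.
- move=> r r' rr'; rewrite /K; case: leP => r1; last exact: sub0set.
  rewrite ifT; last by lra.
  by move=> x /=; have := lo_mono _ _ rr' r1; have := hi_anti _ _ rr' r1; lra.
- move=> r x r0 Kx; rewrite /K; case: leP => r1; last first.
    have r1' : 0 < (1 + r) / 2 < r by lra.
    by have := Kx _ r1'; rewrite /K ifF//; apply/negbTE; rewrite -ltNge; lra.
  have r01 : 0 < r <= 1 by lra.
  apply/andP; split; apply/ler_addgt0Pr => e e0.
    have [r' r'r c] := level_inf_left_cont u r01 e0.
    have := Kx _ r'r; rewrite KE/=; last lra.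
    have /c c' : r' <= r' <= r by lra.
    have : level_inf v r' <= level_inf v r.
      by apply: level_inf_mono; lra.
    by rewrite /lo; lra.
  have [r' r'r c] := level_sup_left_cont u r01 e0.
  have := Kx _ r'r; rewrite KE/=; last lra.
  have /c c' : r' <= r' <= r by lra.
  have : level_sup v r <= level_sup v r'.
    by apply: level_sup_anti; lra.
  by rewrite /hi; lra.
- move=> x; rewrite KE//= => /andP[lx xh] B /nbhs_ballP[e /= e0 eB].
  have e2 : 0 < e / 2 by lra.
  have [r1 /andP[? ?] c1] := level_inf_right_cont0 u e2.
  have [r2 /andP[? ?] c2] := level_sup_right_cont0 u e2.
  pose m := Num.min r1 r2.
  have m0 : 0 < m by rewrite lt_min; lra.
  have m1 : 0 <= m <= r1 by rewrite ge_min lexx /=; lra.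
  have m2 : 0 <= m <= r2 by rewrite ge_min lexx orbT /=; lra.
  have m01 : 0 <= m <= 1 by lra.
  have zm : 0 <= (0 : R) <= m by lra.
  have lom : lo m <= lo 0 + e / 2.
    have := c1 _ m1; have : level_inf v 0 <= level_inf v m.
      by apply: level_inf_mono; lra.
    by rewrite /lo; lra.
  have him : hi 0 - e / 2 <= hi m.
    have := c2 _ m2; have : level_sup v m <= level_sup v 0.
      by apply: level_sup_anti; lra.
    by rewrite /hi; lra.
  have lhm := lo_hi _ m01.
  (* The point of the interval at index [m] nearest to [x]. *)
  exists (Num.max (lo m) (Num.min x (hi m))); split.
    exists m; first by rewrite /= m0; lra.
    by rewrite KE/=; [rewrite le_max lexx ge_max lhm/= ge_min lexx orbT|lra].
  apply: eB; rewrite /ball/= ltr_norml maxEle minEle.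
  by case: (leP x (hi m)) => ?; case: ifP => ?; lra.
- move=> r /andP[_ r1] _ _ l [x + <-] [y + <-] l01; rewrite KE//= => xK yK.
  exists (l * x + (1 - l) * y) => //=.
  have ? : 0 <= 1 - l by lra.
  have ? : 0 <= l by lra.
  have [? ?] : l * lo r <= l * x /\ (1 - l) * lo r <= (1 - l) * y.
    by split; apply: ler_wpM2l => //; lra.
  have [? ?] : l * x <= l * hi r /\ (1 - l) * y <= (1 - l) * hi r.
    by split; apply: ler_wpM2l => //; lra.
  lra.
exists w; apply: fuzzy_eq_endpoints => r r01.
have r1 : r <= 1 by lra.
have [wi ws] : level_inf w r = lo r /\ level_sup w r = hi r.
  apply: level_inf_sup_unique => //; first exact: lo_hi.
  by move=> x; rewrite wE// KE// image_id.
by rewrite level_inf_add// level_sup_add// wi ws /lo /hi !subrKC.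
Qed.

End HukuharaClosed.


(** * Growth rates along a filter *)

Section Rates.
Context {R : realType} {X : Type} (F : set_system X) {FF : Filter F}.
Implicit Types (a b c : X -> R) (w : X -> fuzzy R) (d g : fuzzy R).
Implicit Types (p q : R).

(** Convergence of [w t / c t] to [d], written without division: where [c t]
    vanishes, [w t] has to be zero. *)
Definition has_rate c w d : Prop := forall e, 0 < e ->
  \forall t \near F, Dinf (w t) (c t [*] d) <= e * `|c t|.

(** The weights [p] and [q] stand for [alpha] and [1 - alpha]; keeping them
    independent makes the exchange of the forward and the backward difference a
    symmetry of this predicate. *)
Definition has_diamond_rate p q a b w1 w2 d : Prop := forall e, 0 < e ->
  \forall t \near F,
    Dinf ((p * b t) [*] w1 t [+] (q * a t) [*] w2 t) ((a t * b t) [*] d)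
      <= e * `|a t * b t|.

Lemma has_diamond_rate_sym p q a b w1 w2 d :
  has_diamond_rate p q a b w1 w2 d -> has_diamond_rate q p b a w2 w1 d.
Proof.
move=> H e e0; have := H e e0; apply: filterS => t.
by rewrite fuzzy_addC (mulrC (b t) (a t)).
Qed.

Lemma has_rate_of_cvg a w (a0 : R) (w0 : fuzzy R) : a0 != 0 -> a @ F --> a0 ->
  (forall e, 0 < e -> \forall t \near F, Dinf (w t) w0 <= e) ->
  has_rate a w (a0^-1 [*] w0).
Proof.
move=> a00 aa0 ww0 e e0; set N := fuzzy_norm w0; set m := `|a0|.
have N0 : 0 <= N by exact: Dinf_ge0.
have m0 : 0 < m by rewrite normr_gt0.
have d1 : 0 < e * m / 4 by rewrite divr_gt0// mulr_gt0.
have d2 : 0 < e * m / 4 * (m / (N + 1)).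
  by rewrite mulr_gt0// divr_gt0// ltr_wpDl.
have d3 : 0 < m / 2 by lra.
near=> t.
have tw : Dinf (w t) w0 <= e * m / 4 by near: t; exact: ww0.
have ta : `|a0 - a t| <= e * m / 4 * (m / (N + 1)).
  by near: t; exact: (cvgr_dist_le _ _ aa0).
have tm : `|a0 - a t| <= m / 2 by near: t; exact: (cvgr_dist_le _ _ aa0).
have am : m / 2 <= `|a t|.
  have : m <= `|a0 - a t| + `|a t| by rewrite /m -{1}(subrK (a t) a0) ler_normD.
  by lra.
rewrite fuzzy_scaleA; apply: le_trans (Dinf_triangle w0 _ _) _.
have /le_trans : Dinf w0 ((a t / a0) [*] w0) <= `|1 - a t / a0| * N.
  by rewrite -{1}(fuzzy_scale1 w0); exact: Dinf_scalel.
have -> : 1 - a t / a0 = (a0 - a t) / a0 by rewrite mulrBl divff.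
rewrite normrM normfV -/m => /(_ (e * m / 4)) H.
have /H {}H : `|a0 - a t| / m * N <= e * m / 4.
  rewrite mulrAC ler_pdivrMr//.
  apply: le_trans (ler_wpM2r N0 ta) _; rewrite -[leLHS]mulrA; apply: ler_wpM2l.
    exact: ltW.
  by rewrite mulrAC ler_pdivrMr ?ltr_wpDl// ler_pM2l//; lra.
have : e * (m / 2) <= e * `|a t| by rewrite ler_wpM2l // ltW.
lra.
Unshelve. all: by end_near. Qed.

(** The estimate bounds [q |a| |w2|] by [p |b| |w1| + (|d| + 1) |a b|].  With
    [|w1| <= C + |w2|], the part of the right-hand side proportional to [|w2|]
    is absorbed on the left once [|b|] is small, and the rest tends to zero with
    [b]. *)
Lemma diamond_rate_norm_cvg0 p q a b w1 w2 d (a0 C : R) : 0 < p -> 0 < q ->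
  a0 != 0 -> a @ F --> a0 -> b @ F --> 0 -> 0 <= C ->
  (\forall t \near F, fuzzy_norm (w1 t) <= C + fuzzy_norm (w2 t)) ->
  has_diamond_rate p q a b w1 w2 d ->
  forall e, 0 < e -> \forall t \near F, fuzzy_norm (w2 t) <= e.
Proof.
move=> p0 q0 a00 aa0 b0 C0 w12 dia e e0; set D := fuzzy_norm d.
have D0 : 0 <= D by exact: Dinf_ge0.
set m := `|a0|; have m0 : 0 < m by rewrite normr_gt0.
(* [K] bounds what remains once the multiple of [|w2|] has been absorbed. *)
pose K := p * C + (1 + D) * (2 * m).
have K0 : 0 <= K by rewrite addr_ge0// mulr_ge0; lra.
have d1 : 0 < q * m / 4 / p by rewrite !(mulr_gt0, invr_gt0).
have d2 : 0 < q * m / 4 * (e / (K + 1)).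
  by rewrite !(mulr_gt0, invr_gt0)// ltr_wpDl.
have d3 : 0 < m / 2 by lra.
near=> t.
have tb1 : `|b t| <= q * m / 4 / p.
  by rewrite -normrN -sub0r; near: t; exact: (cvgr_dist_le _ _ b0).
have tb2 : `|b t| <= q * m / 4 * (e / (K + 1)).
  by rewrite -normrN -sub0r; near: t; exact: (cvgr_dist_le _ _ b0).
have tm : `|a0 - a t| <= m / 2 by near: t; exact: (cvgr_dist_le _ _ aa0).
have am : m / 2 <= `|a t|.
  have : m <= `|a0 - a t| + `|a t| by rewrite /m -{1}(subrK (a t) a0) ler_normD.
  by lra.
have am' : `|a t| <= 2 * m.
  have : `|a t| <= m + `|a0 - a t|.
    by rewrite /m -{1}(subKr a0 (a t)) ler_normB.
  by lra.
have w12t : fuzzy_norm (w1 t) <= C + fuzzy_norm (w2 t) by near: t.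
have diat : Dinf ((p * b t) [*] w1 t [+] (q * a t) [*] w2 t) ((a t * b t) [*] d)
    <= 1 * `|a t * b t|.
  by near: t; apply: dia; exact: ltr01.
move: w12t diat; set n1 := fuzzy_norm (w1 t); set n2 := fuzzy_norm (w2 t).
set S := _ [+] _ => w12t diat.
have n20 : 0 <= n2 by exact: Dinf_ge0.
have main : q * `|a t| * n2 <= p * `|b t| * n1 + (1 + D) * (`|a t| * `|b t|).
  have -> : q * `|a t| * n2 = fuzzy_norm ((q * a t) [*] w2 t).
    by rewrite fuzzy_norm_scale normrM (gtr0_norm q0).
  apply: le_trans (fuzzy_norm_le_Dinf _ S) _; apply: lerD.
    by rewrite /S Dinf_addr_norm fuzzy_norm_scale normrM (gtr0_norm p0) lexx.
  apply: le_trans (fuzzy_norm_le_Dinf _ _) (le_trans (lerD diat (lexx _)) _).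
  by rewrite fuzzy_norm_scale normrM -/D; lra.
have B0 : 0 <= `|b t| by [].
have : q * (m / 2) * n2 <= q * `|a t| * n2.
  by rewrite ler_wpM2r// ler_wpM2l// ltW.
have : p * `|b t| * n1 <= p * `|b t| * (C + n2).
  by rewrite ler_wpM2l// mulr_ge0// ltW.
have : (1 + D) * (`|a t| * `|b t|) <= (1 + D) * (2 * m * `|b t|).
  by apply: ler_wpM2l; [exact: addr_ge0 ler01 D0|by apply: ler_wpM2r].
have : p * `|b t| * n2 <= q * m / 4 * n2.
  by rewrite ler_wpM2r// mulrC -ler_pdivlMr.
have : `|b t| * K <= q * m / 4 * e.
  apply: le_trans (ler_wpM2r K0 tb2) _; rewrite -[leLHS]mulrA; apply: ler_wpM2l.
    by rewrite !mulr_ge0 ?invr_ge0 ?ltW.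
  by rewrite mulrAC ler_pdivrMr ?ltr_wpDl// ler_pM2l//; lra.
rewrite /K => h1 h2 h3 h4 h5.
have : q * m / 4 * n2 <= q * m / 4 * e by lra.
by rewrite ler_pM2l// !(mulr_gt0, invr_gt0).
Unshelve. all: by end_near. Qed.

(** Where [b t] is not zero, dividing by [a t * b t] and replacing [w1 / a] by
    its limit [g] puts [p g + (q / b) w2] close to [d].  If this happens
    arbitrarily near the limit, [hukuhara_closed] gives [d = p g + q d'], and
    cancelling [p g] proves convergence to [d'].  If not, [b] vanishes eventually
    and there [w2] is zero, so that any [d'] will do. *)
Lemma has_rate_companion p q a b w1 w2 d g : 0 < p <= 1 -> 0 < q ->
  (\forall t \near F, a t != 0) -> has_rate a w1 g ->
  has_diamond_rate p q a b w1 w2 d ->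
  exists d', has_rate b w2 d'.
Proof.
move=> /andP[p0 p1] q0 a0 rg dia.
have zero e d' t : a t != 0 -> b t = 0 ->
    Dinf ((p * b t) [*] w1 t [+] (q * a t) [*] w2 t) ((a t * b t) [*] d)
      <= e * `|a t * b t| ->
    Dinf (w2 t) (b t [*] d') <= 0.
  move=> at0 ->; rewrite !mulr0 normr0 mulr0 fuzzy_addC fuzzy_add0.
  rewrite -!fuzzy_normE fuzzy_norm_scale pmulr_rle0//.
  by rewrite normr_gt0 mulf_neq0// gt_eqF.
have quot e e' t : a t != 0 -> b t != 0 ->
    Dinf (w1 t) (a t [*] g) <= e' * `|a t| ->
    Dinf ((p * b t) [*] w1 t [+] (q * a t) [*] w2 t) ((a t * b t) [*] d)
      <= e * `|a t * b t| ->
    Dinf (p [*] g [+] (q / b t) [*] w2 t) d <= p * e' + e.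
  move=> at0 bt0 H1 H2.
  apply: le_trans (Dinf_triangle ((p / a t) [*] w1 t [+] (q / b t) [*] w2 t) _ _) _.
  apply: lerD.
    rewrite (fuzzy_addC (p [*] g)) (fuzzy_addC ((p / a t) [*] _)) Dinf_addl.
    rewrite Dinf_sym -fuzzy_scaleA Dinf_scale gtr0_norm// ler_pM2l//.
    rewrite -(fuzzy_scale1 g) -(mulVf at0) -fuzzy_scaleA Dinf_scale normfV.
    by rewrite mulrC ler_pdivrMr ?normr_gt0.
  have ab0 : a t * b t != 0 by rewrite mulf_neq0.
  rewrite -[leLHS]mul1r -(mulVf (_ : `|a t * b t| != 0)) ?normr_eq0//.
  rewrite -mulrA -Dinf_scale fuzzy_scaleDr !fuzzy_scaleA.
  have -> : a t * b t * (p / a t) = p * b t by field.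
  have -> : a t * b t * (q / b t) = q * a t by field.
  by rewrite mulrC ler_pdivrMr ?normr_gt0.
have [H|H] := pselect (forall e, 0 < e ->
    exists z : fuzzy R, Dinf (p [*] g [+] z) d <= e).
  have [z dE] := hukuhara_closed H.
  exists (q^-1 [*] z) => e e0.
  have e2 : 0 < e * q / 2 by rewrite divr_gt0// mulr_gt0.
  have := rg _ e2; have := dia _ e2.
  apply: filterS3 a0 => t at0 diat rgt.
  have [bt0|bt0] := eqVneq (b t) 0.
    by apply: le_trans (zero _ _ _ at0 bt0 diat) _; rewrite mulr_ge0// ltW.
  have := quot _ _ _ at0 bt0 rgt diat; rewrite dE Dinf_addl => Q.
  have {}Q : Dinf ((q / b t) [*] w2 t) z <= e * q.
    by have : p * (e * q / 2) <= e * q / 2 by [rewrite ler_piMl// ltW]; lra.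
  have -> : w2 t = (b t / q) [*] ((q / b t) [*] w2 t).
    rewrite fuzzy_scaleA (_ : _ * _ = 1) ?fuzzy_scale1//.
    by field; rewrite bt0 gt_eqF.
  rewrite (fuzzy_scaleA (b t)) Dinf_scale normrM normfV (gtr0_norm q0) mulrC mulrA.
  by rewrite ler_pdivrMr// mulrAC ler_wpM2r.
have [e e0 He] : exists2 e, 0 < e &
    forall z : fuzzy R, ~ Dinf (p [*] g [+] z) d <= e.
  apply: contrapT => H'; apply: H => e e0; apply: contrapT => nz.
  by apply: H'; exists e => // z dz; apply: nz; exists z.
exists d => e' e'0; have e2 : 0 < e / 2 by rewrite divr_gt0.
have := rg _ e2; have := dia _ e2.
apply: filterS3 a0 => t at0 diat rgt.
have [bt0|bt0] := eqVneq (b t) 0.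
  by apply: le_trans (zero _ _ _ at0 bt0 diat) _; rewrite mulr_ge0// ltW.
have := quot _ _ _ at0 bt0 rgt diat => Q; exfalso; apply: He; apply: le_trans Q _.
by have : p * (e / 2) <= e / 2 by [rewrite ler_piMl// ltW]; lra.
Qed.

(** Both terms of the combination are then multiples of [w1] by scalars [p b] and
    [q b] of the same sign, so that they merge into [b [*] w1]; for scalars of
    opposite signs this would fail. *)
Lemma has_diamond_rate_opp p q a b w1 w2 d : 0 < p -> 0 < q -> p + q = 1 ->
  (\forall t \near F, a t = - b t) ->
  (\forall t \near F, w2 t = -1 [*] w1 t) ->
  (\forall t \near F, b t = 0 -> fuzzy_norm (w1 t) = 0) ->
  has_diamond_rate p q a b w1 w2 d ->
  has_rate a w1 d /\ has_rate b w2 d.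
Proof.
move=> p0 q0 pq ab w12 w10 dia.
suff ra : has_rate a w1 d.
  split=> // e e0; have := ra e e0.
  apply: filterS3 ab w12 => t atE w2E.
  have -> : b t [*] d = -1 [*] (a t [*] d).
    by rewrite fuzzy_scaleA atE mulrNN mul1r.
  by rewrite w2E Dinf_scale normrN1 mul1r -(normrN (b t)) -atE.
move=> e e0; apply: filterS3 ab w12 (filterI w10 (dia e e0)).
move=> t atE w2E [w1E].
rewrite w2E fuzzy_scaleA.
have -> : q * a t * -1 = b t * q by rewrite atE; ring.
rewrite (mulrC p) -!fuzzy_scaleA -fuzzy_scaleDr.
rewrite (fuzzy_scaleDl _ (ltW p0) (ltW q0)) pq fuzzy_scale1.
rewrite fuzzy_scaleA (mulrC (a t)) -fuzzy_scaleA Dinf_scale normrM.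
have [bt0 _|bt0] := eqVneq (b t) 0; last first.
  by rewrite mulrCA ler_pM2l ?normr_gt0.
by rewrite atE bt0 oppr0 -fuzzy_normE w1E// normr0 mulr0.
Qed.

End Rates.


(** * Derivatives on a time scale as growth rates *)

Section TimeScaleDerivatives.
Context {R : realType}.
Context (T : set R) (f : R -> fuzzy R) (s : R) (Ts : T s).
Implicit Types (t e : R).

Lemma sigma_ge : s <= sigma T s.
Proof.
rewrite /sigma; case: asboolP => H.
  apply: ub_le_sup => //; exists s => x Tx; rewrite leNgt; apply/negP => sx.
  by have : [set y | T y /\ s < y] x by []; rewrite H.
by apply: lb_le_inf; [exact/set0P/eqP|move=> x [_ /ltW]].
Qed.

Lemma rho_le : rho T s <= s.
Proof.
rewrite /rho; case: asboolP => H.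
  apply: ge_inf => //; exists s => x Tx; rewrite leNgt; apply/negP => sx.
  by have : [set y | T y /\ y < s] x by []; rewrite H.
by apply: ge_sup; [exact/set0P/eqP|move=> x [_ /ltW]].
Qed.

Lemma sigma_le_of_gt t : T t -> s < t -> sigma T s <= t.
Proof.
move=> Tt st; rewrite /sigma; case: asboolP => H.
  by have : [set y | T y /\ s < y] t by []; rewrite H.
by apply: ge_inf; [exists s => x [_ /ltW]|].
Qed.

Lemma rho_ge_of_lt t : T t -> t < s -> t <= rho T s.
Proof.
move=> Tt st; rewrite /rho; case: asboolP => H.
  by have : [set y | T y /\ y < s] t by []; rewrite H.
by apply: ub_le_sup; [exists s => x [_ /ltW]|].
Qed.

Local Notation F := (within T (nbhs s)).

Lemma near_within_itvP (P : R -> Prop) : (\forall t \near F, P t) <->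
  exists2 e, 0 < e & forall t, s - e < t < s + e -> T t -> P t.
Proof.
split=> [/nbhs_ballP[e /= e0 H]|[e e0 H]]; last first.
  apply/nbhs_ballP; exists e => //= t; rewrite /ball/= => te.
  by apply: H; rewrite -ltr_distlC.
exists e => // t te; apply: H; by rewrite /ball/= ltr_distlC.
Qed.

Lemma cvg_mu : mu T s t @[t --> F] --> mu T s s.
Proof.
apply: cvg_within_filter; apply: cvgB; [exact: cvg_cst|exact: cvg_id].
Qed.

Lemma cvg_nu : nu T s t @[t --> F] --> nu T s s.
Proof.
apply: cvg_within_filter; apply: cvgB; [exact: cvg_id|exact: cvg_cst].
Qed.

Definition forward_diff t := gHdiff (f (sigma T s)) (f t).
Definition backward_diff t := gHdiff (f t) (f (rho T s)).

Lemma Delta_of_rate d :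
  (\forall t \near F, is_gHdiff (f (sigma T s)) (f t) (forward_diff t)) ->
  has_rate F (mu T s) forward_diff d -> is_Delta_gH T f s d.
Proof.
move=> ex H e e0.
have [r r0 rP] := (near_within_itvP _).1 (filterI ex (H e e0)).
by exists r => // t tr Tt; have [? ?] := rP t tr Tt; exists (forward_diff t).
Qed.

Lemma nabla_of_rate d :
  (\forall t \near F, is_gHdiff (f t) (f (rho T s)) (backward_diff t)) ->
  has_rate F (nu T s) backward_diff d -> is_nabla_gH T f s d.
Proof.
move=> ex H e e0.
have [r r0 rP] := (near_within_itvP _).1 (filterI ex (H e e0)).
by exists r => // t tr Tt; have [? ?] := rP t tr Tt; exists (backward_diff t).
Qed.

Lemma diamond_gHdiffs alpha d : is_diamond_gH alpha T f s d ->
  \forall t \near F, is_gHdiff (f (sigma T s)) (f t) (forward_diff t) /\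
                     is_gHdiff (f t) (f (rho T s)) (backward_diff t).
Proof.
move=> /(_ 1 ltr01)[r r0 H]; apply/near_within_itvP; exists r => // t tr Tt.
have [w1 [w2 [h1 h2 _]]] := H t tr Tt.
by rewrite /forward_diff /backward_diff (gHdiffE h1) (gHdiffE h2).
Qed.

Lemma diamond_rate alpha d : is_diamond_gH alpha T f s d ->
  has_diamond_rate F alpha (1 - alpha) (mu T s) (nu T s)
    forward_diff backward_diff d.
Proof.
move=> H e /H[r r0 {}H]; apply/near_within_itvP; exists r => // t tr Tt.
have [w1 [w2 [h1 h2]]] := H t tr Tt.
by rewrite /forward_diff /backward_diff (gHdiffE h1) (gHdiffE h2).
Qed.

Definition cont_at_within := forall e, 0 < e ->
  \forall t \near F, Dinf (f t) (f s) <= e.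

Lemma near_within_self (P : R -> Prop) : (\forall t \near F, P t) -> P s.
Proof. by move=> /near_within_itvP[e e0 H]; apply: H => //; lra. Qed.

(** If exactly one of the jumps is trivial, the corresponding step tends to zero
    and the norm of the corresponding difference is the distance of [f t] to
    [f s]; if none is, [s] is an isolated point of [T]. *)
Lemma diamond_cont alpha d : 0 < alpha < 1 -> is_diamond_gH alpha T f s d ->
  ~ (sigma T s = s /\ rho T s = s) -> cont_at_within.
Proof.
move=> /andP[a0 a1] D nd e e0; have a1' : 0 < 1 - alpha by lra.
have ex := diamond_gHdiffs D; have dr := diamond_rate D.
have [S|S] := eqVneq (sigma T s) s; have [P|P] := eqVneq (rho T s) s.
- by case: nd.
- have nu0 : nu T s s != 0 by rewrite subr_eq0 eq_sym.
  have mu0 : mu T s t @[t --> F] --> 0.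
    by have := cvg_mu; rewrite {2}/mu S subrr.
  have bd : \forall t \near F, fuzzy_norm (backward_diff t) <=
      Dinf (f s) (f (rho T s)) + fuzzy_norm (forward_diff t).
    apply: filterS ex => t [e1 e2].
    rewrite (fuzzy_norm_gHdiff e1) (fuzzy_norm_gHdiff e2) S addrC (Dinf_sym (f s)).
    exact: Dinf_triangle.
  have H : \forall t \near F, fuzzy_norm (forward_diff t) <= e.
    exact: (diamond_rate_norm_cvg0 a1' a0 nu0 cvg_nu mu0 (Dinf_ge0 _ _) bd
      (has_diamond_rate_sym dr)).
  apply: filterS2 ex H => t [e1 e2].
  by rewrite (fuzzy_norm_gHdiff e1) S Dinf_sym.
- have mu0 : mu T s s != 0 by rewrite subr_eq0.
  have nu0 : nu T s t @[t --> F] --> 0.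
    by have := cvg_nu; rewrite {2}/nu P subrr.
  have bd : \forall t \near F, fuzzy_norm (forward_diff t) <=
      Dinf (f (sigma T s)) (f s) + fuzzy_norm (backward_diff t).
    apply: filterS ex => t [e1 e2].
    rewrite (fuzzy_norm_gHdiff e1) (fuzzy_norm_gHdiff e2) P (Dinf_sym (f t)).
    exact: Dinf_triangle.
  have H : \forall t \near F, fuzzy_norm (backward_diff t) <= e.
    exact: (diamond_rate_norm_cvg0 a0 a1' mu0 cvg_mu nu0 (Dinf_ge0 _ _) bd dr).
  by apply: filterS2 ex H => t [e1 e2]; rewrite (fuzzy_norm_gHdiff e2) P.
- have sS : s < sigma T s by rewrite lt_neqAle eq_sym S sigma_ge.
  have Ps : rho T s < s by rewrite lt_neqAle P rho_le.
  apply/near_within_itvP; exists (Num.min (sigma T s - s) (s - rho T s)).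
    by rewrite lt_min; lra.
  move=> t; set m := Num.min _ _ => tm Tt.
  have mS : m <= sigma T s - s by rewrite ge_min lexx.
  have mP : m <= s - rho T s by rewrite ge_min lexx orbT.
  have -> : t = s; last by rewrite Dinf_refl ltW.
  apply/le_anti/andP; split; rewrite leNgt; apply/negP => h.
    by have := sigma_le_of_gt Tt h; lra.
  by have := rho_ge_of_lt Tt h; lra.
Qed.

Lemma diamond_has_rates alpha d :
  0 < alpha < 1 -> is_diamond_gH alpha T f s d ->
  (exists d1, has_rate F (mu T s) forward_diff d1) /\
  (exists d2, has_rate F (nu T s) backward_diff d2).
Proof.
move=> alpha01 D; have ex := diamond_gHdiffs D; have dr := diamond_rate D.
have exD : \forall t \near F, is_gHdiff (f (sigma T s)) (f t) (forward_diff t).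
  by apply: filterS ex => t [].
have exN : \forall t \near F, is_gHdiff (f t) (f (rho T s)) (backward_diff t).
  by apply: filterS ex => t [].
have [exDs exNs] := near_within_self ex.
have [a0 a1 pq] : [/\ 0 < alpha, 0 < 1 - alpha & alpha + (1 - alpha) = 1].
  by split; lra.
have [[S P]|nd] := pselect (sigma T s = s /\ rho T s = s).
  have w12 : \forall t \near F, backward_diff t = -1 [*] forward_diff t.
    apply: filterS exD => t; rewrite /backward_diff P S.
    by move=> /is_gHdiff_opp /gHdiffE.
  have ab : \forall t \near F, mu T s t = - nu T s t.
    by apply: nearW => t; rewrite /mu /nu S P opprB.
  have w10 : \forall t \near F, nu T s t = 0 -> fuzzy_norm (forward_diff t) = 0.
    apply: filterS exD => t /fuzzy_norm_gHdiff ->; rewrite /nu P S.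
    by move=> /subr0_eq ->; rewrite Dinf_refl.
  suff [r1 r2] : has_rate F (mu T s) forward_diff d /\
      has_rate F (nu T s) backward_diff d by split; exists d.
  exact: (has_diamond_rate_opp a0 a1 pq ab w12 w10 dr).
have cf := diamond_cont alpha01 D nd.
have [S|S] := eqVneq (sigma T s) s.
  have nu0 : nu T s s != 0.
    by rewrite subr_eq0; apply/eqP => P; apply: nd; split.
  have r2 : has_rate F (nu T s) backward_diff
      ((nu T s s)^-1 [*] backward_diff s).
    apply: has_rate_of_cvg nu0 cvg_nu _ => e e0.
    apply: filterS2 exN (cf e e0) => t et.
    apply: le_trans; apply: le_trans (Dinf_gHdiff_le et exNs) _.
    by rewrite Dinf_refl addr0.
  split; last by eexists; exact: r2.
  have nu0' : \forall t \near F, nu T s t != 0.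
    exact: cvgr_neq0 cvg_nu nu0.
  apply: (has_rate_companion _ a0 nu0' r2 (has_diamond_rate_sym dr)).
  by lra.
have mu0 : mu T s s != 0 by rewrite subr_eq0.
have r1 : has_rate F (mu T s) forward_diff ((mu T s s)^-1 [*] forward_diff s).
  apply: has_rate_of_cvg mu0 cvg_mu _ => e e0.
  apply: filterS2 exD (cf e e0) => t et.
  apply: le_trans; apply: le_trans (Dinf_gHdiff_le et exDs) _.
  by rewrite Dinf_refl add0r.
split; first by eexists; exact: r1.
have mu0' : \forall t \near F, mu T s t != 0.
  exact: cvgr_neq0 cvg_mu mu0.
apply: (has_rate_companion _ a1 mu0' r1 dr).
by lra.
Qed.

End TimeScaleDerivatives.

Theorem theorem6 (R : realType) (T : set R) (f : R -> fuzzy R) (s alpha : R)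
    (hT : time_scale T) (hs : kappa_both T s) (halpha : 0 < alpha < 1)
    (hf : diamond_gH_differentiable alpha T f s) :
  Delta_gH_differentiable T f s /\ nabla_gH_differentiable T f s.
Proof.
have Ts : T s by case: hs => -[].
have [d D] := hf; have gH := diamond_gHdiffs D.
have [[d1 r1] [d2 r2]] := diamond_has_rates Ts halpha D.
split; [exists d1; apply: Delta_of_rate r1|exists d2; apply: nabla_of_rate r2].
  by apply: filterS gH => t [].
by apply: filterS gH => t [].
Qed.
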